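(* Let $k\ge1$ be an integer and let $\gamma_1,\dots,\gamma_{k-1}$ be the roots of $\Psi_k(x)$. For each $a=1,\dots,k-1$, let $\rho_a$ satisfy \[ \rho_a+\rho_a^{-1}=\gamma_a,\qquad|\rho_a|<1, \] and define \[ V_n^{(a)}:=\frac{\rho_a^n-\rho_a^{-n}}{\rho_a-\rho_a^{-1}}. \] Then \[ V_{n+1}^{(a)}=\gamma_aV_n^{(a)}-V_{n-1}^{(a)} \] holds for all integers $n$.
   Context: For $r\ge1$, $P_r(x)$ is the polynomial defined by $P_r(z+z^{-1})=z^r+z^{-r}$, and $\Phi_k(x)=2k-\sum_{r=1}^kP_r(x)$. The polynomial $\Psi_k$, of degree $k-1$, is defined by $\Phi_k(x)=(2-x)\Psi_k(x)$; its complex roots are distinct (a known fact). *)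

(* Defs.v *)
From HB Require Import structures.
From mathcomp Require Import all_boot all_order all_algebra.
From mathcomp Require Import reals complex ring.

Set Implicit Arguments.
Unset Strict Implicit.
Unset Printing Implicit Defensive.

Import Order.TTheory GRing.Theory Num.Theory.
Local Open Scope ring_scope.

(* The pair (P_r, P_(r+1)), by P_0 = 2, P_1 = X, P_(r+2) = X P_(r+1) - P_r.
   It only serves to show that the polynomial defining P_r exists. *)
Fixpoint P_rec (C : fieldType) (r : nat) : {poly C} * {poly C} :=
  if r is r'.+1 then
    let pq := P_rec C r' in (pq.2, 'X * pq.2 - pq.1)
  else (2%:P, 'X).

Lemma P_recE (C : fieldType) (r : nat) (z : C) : z != 0 ->
  (P_rec C r).1.[z + z^-1] = z ^+ r + z ^- r /\
  (P_rec C r).2.[z + z^-1] = z ^+ r.+1 + z ^- r.+1.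
Proof.
move=> z0; elim: r => [|r [IH1 IH2]] /=.
  by rewrite hornerC hornerX expr0 invr1 !expr1.
split=> //; rewrite !hornerE IH1 IH2 -!exprVn !exprS !exprVn.
by field; rewrite z0 expf_neq0.
Qed.

Lemma P_exists (R : realType) (r : nat) :
  {p : {poly R[i]} |
    forall z : R[i], z != 0 -> p.[z + z^-1] = z ^+ r + z ^- r}.
Proof. by exists (P_rec _ r).1 => z z0; case: (P_recE r z0). Qed.

Definition P (R : realType) (r : nat) : {poly R[i]} := sval (P_exists R r).

Lemma P_spec (R : realType) (r : nat) (z : R[i]) :
  z != 0 -> (P R r).[z + z^-1] = z ^+ r + z ^- r.
Proof. exact: (svalP (P_exists R r)). Qed.

Lemma P_unique (R : realType) (r : nat) (p : {poly R[i]}) :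
  (forall z : R[i], z != 0 -> p.[z + z^-1] = z ^+ r + z ^- r) -> p = P R r.
Proof.
move=> pE; apply/eqP; rewrite -subr_eq0; apply/negPn/negP => d0.
pose s := [seq n%:R : R[i] | n <- iota 0 (size (p - P R r))].
have us : uniq s by rewrite map_inj_uniq ?iota_uniq //; exact: mulrIn (oner_neq0 _).
have rs : all (root (p - P R r)) s.
  apply/allP => _ /mapP[n _ ->]; set x : R[i] := n%:R.
  have [z zE] := @solve_monicpoly R[i] 2
    (fun i => if i == 0%N then -1 else x) isT.
  rewrite !big_ord_recl big_ord0 /= expr0 expr1 mulr1 addr0 in zE.
  have z0 : z != 0.
    apply/eqP => z0; move: zE; rewrite z0 expr0n mulr0 addr0 => /eqP.
    by rewrite eq_sym oppr_eq0 oner_eq0.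
  have -> : x = z + z^-1.
    apply: (mulIf z0); rewrite mulrDl mulVf // -expr2 zE.
    by rewrite addrAC addNr add0r.
  by rewrite /root !hornerE pE // P_spec // subrr.
by have := max_poly_roots d0 rs us; rewrite size_map size_iota ltnn.
Qed.

Definition Phi (R : realType) (k : nat) : {poly R[i]} :=
  (k.*2)%:R%:P - \sum_(1 <= r < k.+1) P R r.

Lemma Psi_exists (R : realType) (k : nat) :
  {q : {poly R[i]} | Phi R k = (2%:P - 'X) * q}.
Proof.
exists (- (Phi R k %/ ('X - 2%:P))).
rewrite mulrN -mulNr opprB mulrC divpK // dvdp_XsubCl /root.
have P2 r : (P R r).[2] = 2.
  rewrite -[X in _.[X]](_ : 1 + 1^-1 = 2) ?P_spec ?oner_neq0 //.
    by rewrite expr1n invr1.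
  by rewrite invr1.
rewrite /Phi hornerD hornerN hornerC horner_sum (eq_bigr (fun=> 2)) //.
by rewrite sumr_const_nat subn1 /= -muln2 mulnC natrM mulr_natr subrr.
Qed.

Definition Psi (R : realType) (k : nat) : {poly R[i]} := sval (Psi_exists R k).

Lemma Psi_spec (R : realType) (k : nat) : Phi R k = (2%:P - 'X) * Psi R k.
Proof. exact: (svalP (Psi_exists R k)). Qed.

Lemma Psi_unique (R : realType) (k : nat) (q : {poly R[i]}) :
  Phi R k = (2%:P - 'X) * q -> q = Psi R k.
Proof.
rewrite Psi_spec => e; apply: esym; move: e; apply: mulfI.
by rewrite -opprB oppr_eq0 polyXsubC_eq0.
Qed.

Lemma size_P (R : realType) (r : nat) : size (P R r.+1) = r.+2.
Proof.
have -> : P R r.+1 = (P_rec _ r).2.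
  by apply/esym/P_unique => z z0; case: (P_recE r z0).
suff: (size (P_rec R[i] r).1 <= r.+1)%N /\ size (P_rec R[i] r).2 = r.+2 by case.
elim: r => [|r [IH1 IH2]] /=; first by rewrite size_polyC size_polyX leq_b1.
split; first by rewrite IH2.
have q0 : (P_rec R[i] r).2 != 0 by rewrite -size_poly_gt0 IH2.
rewrite size_polyDl mulrC size_mulX // IH2 // size_polyN.
by apply: leq_ltn_trans IH1 _.
Qed.

Lemma size_Psi (R : realType) (k : nat) : (1 <= k)%N -> size (Psi R k) = k.
Proof.
case: k => // k _.
have sPhi : size (Phi R k.+1) = k.+2.
  rewrite /Phi big_nat_recr //= opprD addrA addrC size_polyDl size_polyN ?size_P //.
  apply: (@leq_ltn_trans k.+1); last by [].
  apply: leq_trans (size_polyD _ _) _; rewrite size_polyN geq_max.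
  rewrite (leq_trans (size_polyC_leq1 _)) //=.
  rewrite big_add1 /= big_mkord; apply: leq_trans (size_sum _ _ _) _.
  by apply/bigmax_leqP => i _; rewrite size_P ltnS ltn_ord.
have X0 : 'X - 2%:P != 0 :> {poly R[i]} by rewrite polyXsubC_eq0.
have q0 : Psi R k.+1 != 0.
  by apply/eqP => q0; move: sPhi; rewrite Psi_spec q0 mulr0 size_poly0.
move: sPhi; rewrite Psi_spec -opprB mulNr size_polyN size_mul //.
by rewrite size_XsubC => -[].
Qed.

Definition V (R : realType) (rho : R[i]) (n : int) : R[i] :=
  (rho ^ n - rho ^ (- n)) / (rho - rho^-1).

(* Main.v *)
Require Import Defs.
From HB Require Import structures.
From mathcomp Require Import all_boot all_order all_algebra.
From mathcomp Require Import reals complex ring.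

Import Order.TTheory GRing.Theory Num.Theory.
Local Open Scope ring_scope.

(** Both [rho ^ n] and [rho ^ (- n)] solve u(n+1) + u(n-1) = (rho + rho^-1) u(n), since a shift of
    [n] multiplies them by rho or rho^-1. Hence so does [V], their difference times a constant. *)

Theorem lemma3p3 (R : realType) (k : nat) (k_ge1 : (1 <= k)%N)
  (gamma rho : 'I_(k.-1) -> R[i])
  (gamma_inj : injective gamma)
  (gamma_roots : forall x : R[i],
     root (Psi R k) x <-> exists a : 'I_(k.-1), gamma a = x)
  (rho_neq0 : forall a : 'I_(k.-1), rho a != 0)
  (rho_gamma : forall a : 'I_(k.-1), rho a + (rho a)^-1 = gamma a)
  (rho_lt1 : forall a : 'I_(k.-1), `|rho a| < 1) :
  forall (a : 'I_(k.-1)) (n : int),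
    V (rho a) (n + 1) = gamma a * V (rho a) n - V (rho a) (n - 1).
Proof.
move=> a n; rewrite -rho_gamma /V opprD opprB [1 - n]addrC.
(* A nonzero base lets exponents in Z split, leaving only [rho ^ n], [rho ^ (- n)], rho and its
   inverse. *)
rewrite !expfzDr ?rho_neq0 // !expr1z !exprN1.
(* The common factor [(rho - rho^-1)^-1] is just carried along. *)
by ring.
Qed.
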